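(* For all positive integers $a$ and $b$ there exists an $(ab+1,2;a,b;1,1)$-GSEDF (in some abelian group of order $ab+1$).
   Context: Let $G$ be a finite abelian group of order $v$, written additively with identity $0$. For disjoint subsets $A,B\subseteq G$, let $\Delta(A,B)$ be the multiset $\{x-y : x\in A, y\in B\}$. For positive integers $k_1,k_2,\lambda_1,\lambda_2$, a $(v,2;k_1,k_2;\lambda_1,\lambda_2)$-generalized strong external difference family (GSEDF) in $G$ is a pair $\{D_1,D_2\}$ of disjoint nonempty subsets of $G$ with $|D_1|=k_1$, $|D_2|=k_2$ such that $\Delta(D_1,D_2)$ contains every element of $G\setminus\{0\}$ exactly $\lambda_1$ times and $\Delta(D_2,D_1)$ contains every element of $G\setminus\{0\}$ exactly $\lambda_2$ times. *)

(* Defs.v *)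
From mathcomp Require Import all_boot all_order all_algebra.
Set Implicit Arguments.
Unset Strict Implicit.
Unset Printing Implicit Defensive.
Import GRing.Theory.
Local Open Scope ring_scope.

(* A sequence stands for the multiset of its items: the multiplicity of g is
   [count_mem g]. *)
Definition Delta (G : finZmodType) (A B : {set G}) : seq G :=
  [seq x - y | x <- enum A, y <- enum B].

Record is_GSEDF2 (G : finZmodType) (v k1 k2 l1 l2 : nat) (D1 D2 : {set G})
    : Prop := IsGSEDF2 {
  gsedf_order : #|G| = v;
  gsedf_l1_gt0 : (0 < l1)%N;
  gsedf_l2_gt0 : (0 < l2)%N;
  gsedf_D1_neq0 : D1 != set0;
  gsedf_D2_neq0 : D2 != set0;
  gsedf_disjoint : [disjoint D1 & D2];
  gsedf_card1 : #|D1| = k1;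
  gsedf_card2 : #|D2| = k2;
  gsedf_diff12 : forall g : G, g != 0 -> count_mem g (Delta D1 D2) = l1;
  gsedf_diff21 : forall g : G, g != 0 -> count_mem g (Delta D2 D1) = l2
}.

(* Main.v *)
Require Import Defs.
From mathcomp Require Import all_boot all_order all_algebra.
From mathcomp Require Import zify.
Import GRing.Theory.

(** In the cyclic group of order [a * b + 1], take for [D1] the residues
    [0, ..., a - 1] and for [D2] the residues [a, 2a, ..., ba]. The integers
    [a * j - i] with [i < a] and [0 < j <= b] run through [1, ..., a * b] exactly
    once, and the differences in the other order are their opposites. *)

(** In a pair with difference [g] the first entry [x] forces the second to be [x - g], so counting
    pairs amounts to counting the admissible [x]. *)
Lemma count_Delta (G : finZmodType) (A B : {set G}) (g : G) :
  count_mem g (Delta A B) = #|[set x in A | (x - g)%R \in B]|.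
Proof.
rewrite /Delta count_flatten -map_comp sumnE big_map big_enum /=.
rewrite -sum1_card (eq_bigl (fun x => (x \in A) && (x - g \in B)%R)); last first.
  by move=> x; rewrite inE.
rewrite big_mkcondr /=; apply: eq_bigr => x _.
rewrite count_map (eq_count (a2 := pred1 (x - g)%R)); last first.
  by move=> y /=; apply/eqP/eqP => [<-|->]; rewrite subKr.
by rewrite count_uniq_mem ?enum_uniq // mem_enum; case: (_ \in B).
Qed.

(** Reversing pairs matches the two counts; on first entries this is the translation [x] to
    [x - g]. *)
Lemma count_Delta_opp (G : finZmodType) (A B : {set G}) (g : G) :
  count_mem g (Delta A B) = count_mem (- g)%R (Delta B A).
Proof.
rewrite !count_Delta -(card_imset _ (subIr g)); apply: eq_card => y.
apply/imsetP/idP => [[x + ->]|]; rewrite !inE opprK.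
  by rewrite subrK andbC.
by move=> /andP[yB yA]; exists (y + g)%R; rewrite ?inE addrK ?yA.
Qed.

(** Removes the modulus, so that [lia] can reason about differences of residues. *)
Lemma val_subI (n : nat) (x y : 'I_n.+1) :
  val (x - y)%R = if y <= x then x - y else x + n.+1 - y.
Proof.
rewrite /= modnDmr; have := ltn_ord x; have := ltn_ord y => lt_y lt_x.
case: leqP => [le_yx|lt_xy]; last by rewrite modn_small; lia.
have -> : x + (n.+1 - y) = (x - y) + n.+1 by lia.
by rewrite modnDr modn_small //; lia.
Qed.

Section IntervalAndMultiples.

Variables a b : nat.
Hypotheses (a_gt0 : 0 < a) (b_gt0 : 0 < b).

Definition initial_segment := [set x : 'I_(a * b).+1 | x < a].
Definition pos_multiples := [set x : 'I_(a * b).+1 | (0 < x) && (a %| x)].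

Lemma card_initial_segment : #|initial_segment| = a.
Proof.
have le_a : a <= (a * b).+1 by rewrite leqW // leq_pmulr.
rewrite -[RHS]card_ord -(card_codom (f := widen_ord le_a)); last first.
  by move=> i j /(congr1 val) /= /val_inj.
apply: eq_card => x; rewrite inE; apply/idP/codomP => [xa | [i ->] /=].
  by exists (Ordinal xa); apply: val_inj.
exact: ltn_ord.
Qed.

Lemma card_pos_multiples : #|pos_multiples| = b.
Proof.
have lt_ab (i : 'I_b) : a * i.+1 < (a * b).+1.
  by rewrite ltnS leq_mul2l ltn_ord orbT.
rewrite -[RHS]card_ord -(card_codom (f := fun i => Ordinal (lt_ab i))); last first.
  by move=> i j /(congr1 val) /= /eqP; rewrite eqn_pmul2l // => /eqP[/val_inj].
apply: eq_card => x; rewrite inE; apply/idP/codomP => [|[i ->] /=]; last first.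
  by rewrite muln_gt0 a_gt0 dvdn_mulr.
case/andP=> x_gt0 /dvdnP[[|k] xE]; first by rewrite xE in x_gt0.
have lt_kb : k < b.
  by rewrite -(leq_pmul2l a_gt0) -ltnS mulnC -xE ltn_ord.
by exists (Ordinal lt_kb); apply: val_inj; rewrite /= xE mulnC.
Qed.

(** Exactly one of the [a] consecutive integers from [g] to [g + a - 1] is a multiple of [a]. *)
Lemma count_Delta_multiples_segment (g : 'I_(a * b).+1) : g != 0%R ->
  count_mem g (Delta pos_multiples initial_segment) = 1.
Proof.
move=> g_neq0; have g_gt0 : 0 < g by rewrite lt0n.
have lt_g := ltn_ord g.
(* Dividing [g - 1] instead of [g] rounds up: [a * (q + 1) - g = a - 1 - r] lies between [0] and
   [a - 1]. *)
case: (edivnP g.-1 a) => q r gE /implyP/(_ a_gt0) lt_r.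
have lt_qb : q < b by nia.
have lt_y : a * q.+1 < (a * b).+1 by rewrite ltnS leq_mul2l lt_qb orbT.
rewrite count_Delta -(cards1 (Ordinal lt_y)); apply: eq_card => y.
rewrite !inE val_subI -val_eqE /=.
apply/idP/eqP => [/andP[/andP[y_gt0 dvd_ay]]|->]; last first.
  rewrite muln_gt0 a_gt0 dvdn_mulr //= mulnS [a * q]mulnC.
  by case: (leqP g) => ?; lia.
have le_ay := dvdn_leq y_gt0 dvd_ay.
(* A difference that wraps around is [y + (a * b + 1) - g], which exceeds [a] because [a <= y] and
   [g <= a * b]. *)
case: (leqP g) => [le_gy lt_a|lt_yg lt_a]; last by lia.
case/dvdnP: dvd_ay => k yE.
(* From [g <= k * a < g + a] it follows that [q * a < k * a < (q + 2) * a]. *)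
have lt_qk : q < k by rewrite -(ltn_pmul2r a_gt0); lia.
have lt_kq : k < q.+2 by rewrite -(ltn_pmul2r a_gt0) !mulSn; lia.
have <- : k = q.+1 by lia.
by rewrite yE mulnC.
Qed.

End IntervalAndMultiples.

Theorem theorem4p4 (a b : nat) (ha : (0 < a)%N) (hb : (0 < b)%N) :
  exists (G : finZmodType) (D1 D2 : {set G}),
    is_GSEDF2 (a * b + 1)%N a b 1 1 D1 D2.
Proof.
exists 'I_(a * b).+1, (initial_segment a b), (pos_multiples a b).
have card1 := card_initial_segment a b hb.
have card2 := card_pos_multiples a b ha.
split=> //.
- by rewrite card_ord addn1.
- by rewrite -card_gt0 card1.
- by rewrite -card_gt0 card2.
- rewrite -setI_eq0; apply/eqP/setP => x; rewrite !inE.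
  apply/negP => /and3P[lt_xa x_gt0 /(dvdn_leq x_gt0)].
  by rewrite leqNgt lt_xa.
- move=> g g_neq0; rewrite count_Delta_opp.
  by apply: count_Delta_multiples_segment; rewrite ?oppr_eq0.
- by move=> g; apply: count_Delta_multiples_segment.
Qed.
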